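(* Let $\xi_1$ be a standard normal $N(0,1)$ random variable and let $x_1,\dots,x_n\in\mathbb R$ satisfy $x_1^2+\cdots+x_n^2=1$. Let $\epsilon_1,\dots,\epsilon_n$ be independent with $\mathbf P(\epsilon_i=1)=\mathbf P(\epsilon_i=-1)=\frac12$. Then for every $f\in C^2_{conv}$ $$\mathbf E f(\epsilon_1x_1+\cdots+\epsilon_nx_n)\le\mathbf E f(\xi_1).$$ If, moreover, $f\in C^2_{\uparrow,conv}$, then also $$\mathbf E f(\eta_1x_1+\cdots+\eta_nx_n)\le\mathbf E f(\xi_1)$$ for all independent random variables $\eta_1,\dots,\eta_n$ with $\mathbf E\eta_i=0$ and $|\eta_i|\le1$ with probability $1$.
   Context: $C^2_{conv}$ is the class of all even functions $f:\mathbb R\to\mathbb R$ having a finite and convex second derivative $f''$ on $\mathbb R$. $C^2_{\uparrow,conv}$ is the class of all $f\in C^2_{conv}$ with $f(0)\ge0$ and $f''(0)\ge0$. The right-hand sides may be $+\infty$. *)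

(* Defs.v *)
From HB Require Import structures.
From mathcomp Require Import all_boot all_order all_algebra.
From mathcomp Require Import all_classical all_reals all_analysis.

Set Implicit Arguments.
Unset Strict Implicit.
Unset Printing Implicit Defensive.

Import Order.TTheory GRing.Theory Num.Theory.
Import numFieldNormedType.Exports.

Local Open Scope classical_set_scope.
Local Open Scope ring_scope.

(* [derive1] is total, so the existence of f'' is stated separately. *)
Definition C2_conv (R : realType) (f : R -> R) : Prop :=
  [/\ forall t : R, f (- t) = f t,
      forall t : R, derivable f t 1,
      forall t : R, derivable f^`()%classic t 1 &
      convex_function [set: R^o] f^`(2)%classic].

Definition C2_up_conv (R : realType) (f : R -> R) : Prop :=
  [/\ C2_conv f, 0 <= f 0 & 0 <= f^`(2)%classic 0].

Definition mutually_independent (d : measure_display) (T : measurableType d)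
    (R : realType) (P : probability T R) (n : nat)
    (X : 'I_n -> {RV P >-> R}) : Prop :=
  forall (J : {set 'I_n}) (B : 'I_n -> set R),
    (forall i, i \in J -> measurable (B i)) ->
    P (\bigcap_(i in [set` J]) (X i @^-1` B i)) =
    (\prod_(i in J) P (X i @^-1` B i))%E.

Definition rademacher (d : measure_display) (T : measurableType d)
    (R : realType) (P : probability T R) (X : {RV P >-> R}) : Prop :=
  P [set w | X w = 1] = (2^-1)%:E /\ P [set w | X w = -1] = (2^-1)%:E.

(* The second parameter of [normal_prob] is the standard deviation. *)
Definition standard_normal (d : measure_display) (T : measurableType d)
    (R : realType) (P : probability T R) (X : {RV P >-> R}) : Prop :=
  forall A : set R, measurable A -> distribution P X A = normal_prob 0 1 A.

(* Main.v *)
Require Import Defs.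
From HB Require Import structures.
From mathcomp Require Import all_boot all_order all_algebra.
From mathcomp Require Import all_classical all_reals all_analysis.
From mathcomp Require Import ring lra.

Set Implicit Arguments.
Unset Strict Implicit.
Unset Printing Implicit Defensive.

Import Order.TTheory GRing.Theory Num.Theory.
Import numFieldNormedType.Exports.

Local Open Scope classical_set_scope.
Local Open Scope ring_scope.
Import measurable_realfun.

(** The proof replaces the random signs by Gaussian variables one at a time.

    One coordinate.  If F'' is convex then, for fixed a and x, the even
    function phi(t) = (F(a + xt) + F(a - xt)) / 2 has a second derivative that
    is nondecreasing for t >= 0.  Hence phi'(t) / t is nondecreasing there, that
    is, phi(t) is a convex function of t^2.  Jensen's inequality for the square
    of a standard normal variable xi, of mean 1, gives phi(1) <= E phi(xi): a
    sign is dominated by a normal variable with the same variance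
    ([rademacher_le_gauss_mean]).  Jensen's inequality appears as the tangent
    inequality phi(t) >= phi(1) + phi'(1) (t^2 - 1) / 2
    ([symmetrized_quadratic_minorant]) integrated with E xi^2 = 1
    ([second_moment_gauss_pdf]).

    All coordinates.  Since sums of independent normal variables are normal
    ([gauss_mean_conv]), induction on the number of coordinates bounds the
    average of F(a + sum of +-x_i) over all signs by E F(a + r xi), where
    r^2 is the sum of the x_i^2 ([signed_mix_le_gauss_mean]).  This is done for
    F >= 0, so that all integrals make sense in [0, +oo].  A function f of the
    class C^2_conv lies above q(t) = f(0) + f''(0) t^2 / 2, because f'' is
    minimal at 0, so the bound applies to F = f - q; and q has the same mean on
    both sides ([signed_mix_le_standard_normal]).

    From random variables to signs.  Let b_s(y) = (1 + s y) / 2 for s = +-1.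
    For a convex f and |y_i| <= 1, splitting each y_i into the two points 1 and
    -1 with these weights gives
      f(sum of y_i x_i) <= sum over s of (prod of b_{s_i}(y_i)) f(sum of s_i x_i)
    ([le_signed_mix]); for y_i = +-1 this is an equality for every f
    ([signed_mix_eq]).  Putting y_i = eta_i and taking expectations, independence
    ([expectation_prod_independent]) and E eta_i = 0 turn every product of
    weights into 2^-n, so the right-hand side becomes the average over signs. *)

(** * Integration against a density and products of independent variables *)

Section density.
Import HBNNSimple.

(** Change of variables with a weight.  The hypothesis is the conclusion for
    indicators; simple functions and monotone convergence do the rest.  It
    serves both for measures given by a density (phi the identity) and for
    independence (W a function of the other variables, nu a multiple of the law
    of phi). *)
Lemma ge0_integral_density d1 d2 (X : measurableType d1)
    (Y : measurableType d2) (R : realType) (phi : X -> Y)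
    (mphi : measurable_fun setT phi) (mu : {measure set X -> \bar R})
    (nu : {measure set Y -> \bar R}) (W : X -> R) (g : Y -> R) :
  measurable_fun setT W -> (forall x, 0 <= W x) ->
  (forall B, measurable B -> \int[mu]_(x in phi @^-1` B) (W x)%:E = nu B)%E ->
  measurable_fun setT g -> (forall y, 0 <= g y) ->
  (\int[mu]_x (g (phi x) * W x)%:E = \int[nu]_y (g y)%:E)%E.
Proof.
move=> mW W0 WnuB mg g0.
have mg' : measurable_fun [set: Y] (fun y => (g y)%:E) by exact/measurable_EFinP.
pose f_ := nnsfun_approx measurableT mg'.
have mphiB B : measurable B -> measurable (phi @^-1` B).
  by move=> mB; rewrite -(setTI (_ @^-1` _)); exact: mphi.
have f_cvg y : (f_ n y)%:E @[n --> \oo] --> (g y)%:E.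
  by apply: (@cvg_nnsfun_approx _ _ _ _ measurableT _ mg') => // z _; rewrite lee_fin.
have f_nd y : {homo (fun n => f_ n y) : m n / (m <= n)%N >-> m <= n}.
  by move=> m n mn; exact/lefP/nd_nnsfun_approx.
have mfphi n : measurable_fun setT (fun x => f_ n (phi x)).
  by apply: measurableT_comp => //.
transitivity (limn (fun n => \int[nu]_y (f_ n y)%:E))%E; last first.
  rewrite -monotone_convergence//.
  - by apply: eq_integral => y _; apply/cvg_lim => //; exact: f_cvg.
  - by move=> n; exact/measurable_EFinP.
  - by move=> n y _; rewrite lee_fin.
  - by move=> y _ m n mn; rewrite lee_fin; exact: f_nd.
rewrite [X in limn X](_ : _ =
    (fun n => \int[mu]_x (f_ n (phi x) * W x)%:E))%E; last first.
  apply/funext => n.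
  have mind k : measurable_fun [set: X] (fun x => \1_(f_ n @^-1` [set k]) (phi x) : R).
    by apply: measurableT_comp.
  under eq_integral do rewrite fimfunE -fsumEFin//.
  rewrite ge0_integral_fsum//; last 2 first.
  - by move=> k; exact/measurable_EFinP/measurable_funM.
  - by move=> k y _; rewrite nnfun_muleindic_ge0.
  transitivity (\sum_(k \in range (f_ n)) \int[mu]_x
      (k * \1_(f_ n @^-1` [set k]) (phi x) * W x)%:E)%E.
    apply: eq_fsbigr => k /[!inE] -[z _ fzk].
    have k0 : 0 <= k by rewrite -fzk.
    rewrite integralZl_indic_nnsfun// integral_indic//= setIT.
    under [RHS]eq_integral do rewrite -mulrA EFinM.
    have mWk : measurable_fun [set: X]
        (fun x => (\1_(f_ n @^-1` [set k]) (phi x) * W x)%:E).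
      by apply/measurable_EFinP; exact: measurable_funM.
    rewrite ge0_integralZl//=; last by move=> x _; rewrite lee_fin mulr_ge0.
    congr (_ * _)%E; rewrite -WnuB//.
    rewrite [LHS]integral_mkcond; apply: eq_integral => x _.
    rewrite patchE/= indicE.
    rewrite [in LHS](_ : (x \in phi @^-1` (f_ n @^-1` [set k])) =
      (phi x \in f_ n @^-1` [set k])).
      by case: ifPn => _; rewrite ?mul1r ?mul0r.
    by apply/idP/idP; rewrite !inE.
  rewrite -ge0_integral_fsum//.
  - apply: eq_integral => x _; rewrite fsumEFin//; congr EFin.
    by rewrite -mulr_fsuml -fimfunE.
  - by move=> k; apply/measurable_EFinP; apply: measurable_funM => //; exact: measurable_funM.
  - move=> k x _; rewrite lee_fin mulr_ge0//.
    by have := nnfun_muleindic_ge0 (f_ n) k (phi x); rewrite lee_fin.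
rewrite -monotone_convergence//.
- apply: eq_integral => x _; apply/esym/cvg_lim => //.
  under eq_fun do rewrite EFinM.
  by rewrite EFinM; apply: cvgeZr => //; exact: f_cvg.
- by move=> n; apply/measurable_EFinP; exact: measurable_funM.
- by move=> n x _; rewrite lee_fin mulr_ge0.
- by move=> x _ m n mn; rewrite lee_fin ler_wpM2r//; exact: f_nd.
Qed.

End density.

(** Independence gives the product rule for indicators; the indicators are
    replaced by the h i one index at a time.  At each replacement the product W
    of the other factors is a weight for which [ge0_integral_density] applies,
    with nu a multiple of the law of the variable concerned. *)
Lemma expectation_prod_independent d (T : measurableType d) (R : realType)
    (P : probability T R) (n : nat) (X : 'I_n -> {RV P >-> R})
    (h : 'I_n -> R -> R) :
  mutually_independent X ->
  (forall i, measurable_fun setT (h i)) -> (forall i y, 0 <= h i y <= 1) ->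
  (\int[P]_w (\prod_(i < n) h i (X i w))%:E =
   \prod_(i < n) \int[P]_w (h i (X i w))%:E)%E.
Proof.
move=> Xind mh h01.
have mX i : measurable_fun [set: T] (X i : T -> R) by [].
(* From index k on, the factors are still indicators. *)
suff ind (k : nat) : forall h : 'I_n -> R -> R,
    (forall i, measurable_fun setT (h i)) -> (forall i y, 0 <= h i y <= 1) ->
    (forall i : 'I_n, (k <= i)%N ->
      exists2 B : set R, measurable B & h i = \1_B) ->
    (\int[P]_w (\prod_(i < n) h i (X i w))%:E =
     \prod_(i < n) \int[P]_w (h i (X i w))%:E)%E.
  by apply: (ind n) => // i; rewrite leqNgt ltn_ord.
move=> {h mh h01}.
elim: k => [|k IHk] h mh h01 hind.
  have /choice[B hB] : forall i, exists B : set R, measurable B /\ h i = \1_B.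
    by move=> i; have [B mB ->] := hind i isT; exists B.
  have mXB i : measurable (X i @^-1` B i).
    by rewrite -(setTI (_ @^-1` _)); apply: mX => //; case: (hB i).
  have hE i w : h i (X i w) = \1_(X i @^-1` B i) w.
    by rewrite (hB i).2 !indicE; congr (nat_of_bool _)%:R; apply/idP/idP; rewrite !inE.
  under [RHS]eq_bigr => i _.
    under eq_integral do rewrite hE.
    rewrite integral_indic// setIT; over.
  have := Xind [set: 'I_n]%SET B (fun i _ => (hB i).1).
  under [in RHS]eq_bigl do rewrite finset.in_setT.
  move=> <-.
  set A := \bigcap_(_ in _) _.
  have mA : measurable A by apply: fin_bigcap_measurable => // i _.
  rewrite -[P A]/(P A) -[in RHS](setIT A) -integral_indic//.
  apply: eq_integral => w _; congr EFin.
  under eq_bigr do rewrite hE.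
  rewrite indicE; have [wA|wA] := boolP (w \in A).
    rewrite big1// => i _; rewrite indicE mem_set//.
    by move: wA; rewrite inE; apply => /=; rewrite finset.in_setT.
  have : ~ A w by move=> Aw; move/negP: wA; apply; rewrite inE.
  move/existsNP => [i /not_implyP[_ wi]].
  by rewrite (bigD1 i)//= indicE memNset// mul0r.
have [kn|nk] := ltnP k n; last first.
  by apply: IHk => // i ki; have := ltn_ord i; rewrite ltnNge (leq_trans nk ki).
pose j := Ordinal kn.
pose W w := \prod_(i < n | i != j) h i (X i w).
have mW : measurable_fun [set: T] W.
  rewrite (_ : W = fun w => \prod_(i < n) if i != j then h i (X i w) else 1).
    apply: measurable_prod => i _; case: (i != j) => //; exact: measurableT_comp.
  by apply/funext => w; rewrite /W big_mkcond.
have W0 w : 0 <= W w by apply: prodr_ge0 => i _; case/andP: (h01 i (X i w)).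
pose C := (\prod_(i < n | i != j) \int[P]_w (h i (X i w))%:E)%E.
have C0 : (0 <= C)%E.
  apply: prode_ge0 => i _; apply: integral_ge0 => w _.
  by rewrite lee_fin; case/andP: (h01 i (X i w)).
have Cfin : C \is a fin_num.
  apply: prode_fin_num => i _; rewrite ge0_fin_numE; last first.
    by apply: integral_ge0 => w _; rewrite lee_fin; case/andP: (h01 i (X i w)).
  apply: (@le_lt_trans _ _ (\int[P]_w (1 : R)%:E)%E).
    apply: ge0_le_integral => //.
    - by move=> w _; rewrite lee_fin; case/andP: (h01 i (X i w)).
    - by apply/measurable_EFinP; exact: measurableT_comp.
    - by move=> w _; rewrite lee_fin; case/andP: (h01 i (X i w)).
  by rewrite integral_cst//= mul1e probability_setT ltry.
have c0 : 0 <= fine C by exact: fine_ge0.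
have prodE (g : R -> R) : measurable_fun setT g -> (forall y, 0 <= g y <= 1) ->
    (exists2 B : set R, measurable B & g = \1_B) ->
    (\int[P]_w (g (X j w) * W w)%:E = \int[P]_w (g (X j w))%:E * C)%E.
  move=> mg g01 gB; pose h' i := if i == j then g else h i.
  have := IHk h'.
  have h'j : h' j = g by rewrite /h' eqxx.
  under eq_integral do rewrite (bigD1 j)//= h'j.
  rewrite (bigD1 j)//= h'j => IH; transitivity (\int[P]_w
    (g (X j w) * \prod_(i < n | i != j) h' i (X i w))%:E)%E.
    apply: eq_integral => w _; congr (_ * _)%:E; apply: eq_bigr => i ij.
    by rewrite /h' (negbTE ij).
  rewrite IH; last 3 first.
  - by move=> i; rewrite /h'; case: ifP.
  - by move=> i y; rewrite /h'; case: ifP.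
  - move=> i ki; rewrite /h'; case: eqVneq => // ij.
    apply: hind; rewrite ltn_neqAle ki andbT.
    by apply: contra_neq ij => kiE; exact/val_inj.
  congr (_ * _)%E; apply: eq_bigr => i ij.
  by apply: eq_integral => w _; rewrite /h' (negbTE ij).
rewrite (bigD1 j)//= -/C.
under eq_integral do rewrite (bigD1 j)//=.
pose nu := mscale (NngNum c0) (distribution P (X j)).
transitivity (\int[nu]_y (h j y)%:E)%E; last first.
  have h0 y : 0 <= h j y by case/andP: (h01 j y).
  have mhj : measurable_fun [set: R] (EFin \o h j) by exact/measurable_EFinP.
  rewrite ge0_integral_mscale//=; last by move=> y _; rewrite lee_fin.
  rewrite fineK// muleC; congr (_ * _)%E.
  by rewrite ge0_integral_pushforward// => y _; rewrite lee_fin.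
apply: ge0_integral_density => //.
  move=> B mB.
  have mB1 : measurable_fun [set: R] (\1_B : R -> R) by exact: measurable_indic.
  have B01 y : 0 <= (\1_B : R -> R) y <= 1 by rewrite indicE ler0n lern1 leq_b1.
  have preB w : (\1_B (X j w) : R) = \1_(X j @^-1` B) w.
    by rewrite !indicE; congr (nat_of_bool _)%:R; apply/idP/idP; rewrite !inE.
  have mXB : measurable (X j @^-1` B) by rewrite -(setTI (_ @^-1` _)); exact: mX.
  transitivity (\int[P]_w (\1_B (X j w) * W w)%:E)%E.
    rewrite integral_mkcond; apply: eq_integral => w _.
    by rewrite patchE preB indicE; case: ifPn => _; rewrite ?mul1r ?mul0r.
  rewrite prodE//; last by exists B.
  under eq_integral do rewrite preB.
  rewrite integral_indic// setIT.
  by rewrite /nu/= /mscale/= fineK// muleC.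
by move=> y; case/andP: (h01 j y).
Qed.

(** * The standard Gaussian density *)

Notation gauss_pdf := (normal_pdf 0 1).

Section standard_gaussian.
Context {R : realType}.
Notation mu := (@lebesgue_measure R).
Implicit Types (f g : R -> R) (t : R).

Lemma gauss_pdfE t : gauss_pdf t = normal_peak 1 * expR (- t ^+ 2 / 2) :> R.
Proof. by rewrite normal_pdfE ?oner_neq0// /normal_fun subr0 expr1n. Qed.

Lemma gauss_pdfN t : gauss_pdf (- t) = gauss_pdf t :> R.
Proof. by rewrite !gauss_pdfE sqrrN. Qed.

Lemma continuous_gauss_pdf : continuous (gauss_pdf : R -> R).
Proof. by apply: continuous_normal_pdf; exact: oner_neq0. Qed.

Lemma integral_normal_prob g :
  measurable_fun setT g -> (forall y, 0 <= g y) ->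
  (\int[normal_prob 0 1]_y (g y)%:E = \int[mu]_t (g t * gauss_pdf t)%:E)%E.
Proof.
move=> mg g0; apply/esym.
apply: (@ge0_integral_density _ _ (measurableTypeR R) (measurableTypeR R) R id _
  mu (normal_prob 0 1) gauss_pdf g) => //.
- exact: measurable_normal_pdf.
- by move=> t; exact: normal_pdf_ge0.
Qed.

Lemma ge0_integral_opp (f : R -> R) :
  measurable_fun setT f -> (forall t, 0 <= f t) ->
  (\int[mu]_t (f (- t))%:E = \int[mu]_t (f t)%:E)%E.
Proof.
move=> mf f0.
have mf' : measurable_fun [set: R] (EFin \o f) by exact/measurable_EFinP.
transitivity (\int[mu]_(t in (-%R : _ -> measurableTypeR R) @^-1` setT)
    ((EFin \o f) \o -%R) t)%E => //.
rewrite -ge0_integral_pushforward//=; last by move=> y _; rewrite lee_fin.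
apply/esym; apply: eq_measure_integral => /= A mA _.
exact/esym/lebesgue_measureN.
Qed.

Lemma is_derive_gauss_pdf t : is_derive t 1 (gauss_pdf : R -> R) (- (t * gauss_pdf t)).
Proof.
rewrite (_ : gauss_pdf = (fun t => normal_peak 1 * expR (- t ^+ 2 / 2)) :> (R -> R)); last first.
  by apply/funext => s; rewrite gauss_pdfE.
apply: is_derive_eq.
by rewrite /GRing.scale/=; field.
Qed.

Lemma is_derive_id_gauss_pdf t :
  is_derive t 1 (fun s : R => s * gauss_pdf s) ((1 - t ^+ 2) * gauss_pdf t).
Proof.
have d := is_derive_gauss_pdf t.
apply: is_derive_eq; rewrite /GRing.scale/=; ring.
Qed.

Lemma cvg_id_gauss_pdf : (s * gauss_pdf s : R) @[s --> +oo] --> (0 : R).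
Proof.
apply: (@squeeze_cvgr _ _ _ _ (cst 0) (fun s : R => normal_peak 1 * 2 * s^-1)).
(* The bound exp(u) >= u for u = s^2 / 2 gives s exp(- s^2 / 2) <= 2 / s. *)
- near=> s; have s0 : 0 < s by near: s; exact: nbhs_pinfty_gt.
  rewrite mulr_ge0 ?normal_pdf_ge0 ?(ltW s0)//= gauss_pdfE.
  rewrite mulrCA -mulrA ler_wpM2l ?normal_peak_ge0//.
  have -> : 2 * s^-1 = s * (s ^+ 2 / 2)^-1 by field; rewrite gt_eqF.
  rewrite ler_wpM2l ?(ltW s0)// mulNr expRN lef_pV2 ?posrE ?expR_gt0//.
    by have := expR_ge1Dx (s ^+ 2 / 2); lra.
  by rewrite divr_gt0 ?exprn_gt0.
- exact: cvg_cst.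
- rewrite -[X in _ --> X](mulr0 (normal_peak 1 * 2)).
  apply: cvgM; first exact: cvg_cst.
  apply/gtr0_cvgV0; last exact: cvg_id.
  exact: nbhs_pinfty_gt.
Unshelve. all: by end_near. Qed.

(** The primitive of (1 - t^2) p(t) is t p(t), which vanishes at 0 and at
    infinity; cutting the half-line at 1, where 1 - t^2 changes sign, keeps all
    integrands nonnegative. *)
Lemma second_moment_gauss_pdf :
  (\int[mu]_t (t ^+ 2 * gauss_pdf t)%:E = 1)%E.
Proof.
have pdf0 t : 0 <= gauss_pdf t :> R by exact: normal_pdf_ge0.
have cpdf := continuous_gauss_pdf.
have csq : continuous (fun t : R => t ^+ 2 * gauss_pdf t).
  by move=> t; apply: cvgM; [exact: exprn_continuous|exact: cpdf].
have c1 : continuous (fun t : R => (1 - t ^+ 2) * gauss_pdf t).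
  move=> t; apply: cvgM; last exact: cpdf.
  by apply: cvgB; [exact: cvg_cst|exact: exprn_continuous].
have cneg : continuous (fun t : R => (t ^+ 2 - 1) * gauss_pdf t).
  move=> t; apply: cvgM; last exact: cpdf.
  by apply: cvgB; [exact: exprn_continuous|exact: cvg_cst].
have cid : continuous (fun s : R => s * gauss_pdf s).
  by move=> t; apply: cvgM; [exact: cvg_id|exact: cpdf].
have cidN : continuous (fun s : R => - (s * gauss_pdf s)).
  by move=> t; apply: cvgN; exact: cid.
have didN t : is_derive t 1 (fun s : R => - (s * gauss_pdf s))
    ((t ^+ 2 - 1) * gauss_pdf t).
  by have d := is_derive_id_gauss_pdf t; apply: is_derive_eq; ring.
have half (f : R -> R) : continuous f -> (forall t, 0 <= f t) ->
    (\int[mu]_(t in [set t : R | (0 <= t)%R]) (f t)%:E =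
     \int[mu]_(t in `[0%R, 1%R]) (f t)%:E + \int[mu]_(t in `[1%R, +oo[) (f t)%:E)%E.
  move=> cf f0.
  have mf : measurable_fun [set: R] (EFin \o f).
    by apply/measurable_EFinP; exact: continuous_measurable_fun.
  have -> : [set t : R | (0 <= t)%R] = `[0, 1] `|` `]1, +oo[.
    apply/seteqP; split => t /=; rewrite !in_itv/= ?andbT.
      by move=> t0; case: (leP t 1) => t1; [left; rewrite t0|right].
    by case=> [/andP[]//|/ltW]; exact: le_trans.
  rewrite ge0_integral_setU//=.
  - congr (_ + _)%E; rewrite integral_itv_obnd_cbnd//.
    exact: measurable_funTS.
  - exact: measurable_funTS.
  - by move=> t _; rewrite lee_fin.
  - apply/disj_setPLR => t /=; rewrite !in_itv/= andbT => /andP[_].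
    by move=> t1; apply/negP; rewrite -leNgt.
have intpdf : (2 * \int[mu]_(t in [set t : R | (0 <= t)%R]) (gauss_pdf t)%:E = 1)%E.
  rewrite -ge0_symfun_integralT//; first exact: integral_normal_pdf.
  by move=> t /=; rewrite gauss_pdfN.
rewrite ge0_symfun_integralT//; last 2 first.
- by move=> t; rewrite mulr_ge0 ?sqr_ge0.
- by move=> t /=; rewrite gauss_pdfN sqrrN.
rewrite -intpdf !half//; last by move=> t; rewrite mulr_ge0 ?sqr_ge0.
congr (2 * _)%E.
have -> : (\int[mu]_(t in `[0%R, 1%R]) (gauss_pdf t)%:E =
    (gauss_pdf 1)%:E + \int[mu]_(t in `[0%R, 1%R]) (t ^+ 2 * gauss_pdf t)%:E)%E.
  have <- : (\int[mu]_(t in `[0%R, 1%R]) ((1 - t ^+ 2) * gauss_pdf t)%:E =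
      (gauss_pdf 1)%:E)%E.
    rewrite (@continuous_FTC2 _ _ (fun s : R => s * gauss_pdf s))//.
    - by rewrite mul1r mul0r sube0.
    - exact: continuous_subspaceT.
    - split.
      + by move=> t _; case: (is_derive_id_gauss_pdf t).
      + by apply: cvg_at_right_filter; exact: cid.
      + by apply: cvg_at_left_filter; exact: cid.
    - by move=> t _; rewrite derive1E; case: (is_derive_id_gauss_pdf t).
  rewrite -ge0_integralD//=.
  - by apply: eq_integral => t _; rewrite -EFinD; congr EFin; ring.
  - move=> t; rewrite in_itv/= => /andP[t0 t1].
    by rewrite lee_fin mulr_ge0// subr_ge0 exprn_ile1.
  - by apply/measurable_EFinP/measurable_funTS; exact: continuous_measurable_fun.
  - by move=> t _; rewrite lee_fin mulr_ge0 ?sqr_ge0.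
  - by apply/measurable_EFinP/measurable_funTS; exact: continuous_measurable_fun.
have -> : (\int[mu]_(t in `[1%R, +oo[) (t ^+ 2 * gauss_pdf t)%:E =
    (gauss_pdf 1)%:E + \int[mu]_(t in `[1%R, +oo[) (gauss_pdf t)%:E)%E.
  have <- : (\int[mu]_(t in `[1%R, +oo[) ((t ^+ 2 - 1) * gauss_pdf t)%:E =
      (gauss_pdf 1)%:E)%E.
    rewrite (@ge0_continuous_FTC2y _ _ (fun s : R => - (s * gauss_pdf s)) _ 0)//.
    - by rewrite mul1r sub0e EFinN oppeK.
    - move=> t t1; rewrite mulr_ge0// subr_ge0 exprn_ege1//.
    - exact: continuous_subspaceT.
    - by rewrite -[X in _ --> X]oppr0; apply: cvgN; exact: cvg_id_gauss_pdf.
    - by apply: cvg_at_right_filter; exact: cidN.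
    - by move=> t _; rewrite derive1E; case: (didN t).
  rewrite -ge0_integralD//=.
  - by apply: eq_integral => t _; rewrite -EFinD; congr EFin; ring.
  - move=> t; rewrite in_itv/= andbT => t1.
    by rewrite lee_fin mulr_ge0// subr_ge0 exprn_ege1.
  - by apply/measurable_EFinP/measurable_funTS; exact: continuous_measurable_fun.
  - by move=> t _; rewrite lee_fin.
  - by apply/measurable_EFinP/measurable_funTS; exact: continuous_measurable_fun.
by rewrite addeA [in RHS](addeC (gauss_pdf 1)%:E).
Qed.

End standard_gaussian.

(** * Gaussian means and their convolution *)

Section gauss_mean.
Context {R : realType}.
Notation mu := (@lebesgue_measure R).
Implicit Types (F : R -> R) (a s t u x : R).

(** The mean of F under N(a, s^2).  Written with the standard density rather
    than with the density of N(a, s^2), it also makes sense for s = 0, where it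
    is F a. *)
Definition gauss_mean F a s : \bar R :=
  (\int[mu]_t (F (a + s * t) * gauss_pdf t)%:E)%E.

Lemma normal_peakV s : 0 < s -> normal_peak s = s^-1 * normal_peak 1.
Proof.
move=> s0; rewrite /normal_peak expr1n mul1r -mulrnAr sqrtrM ?sqr_ge0//.
by rewrite sqrtr_sqr gtr0_norm// invfM.
Qed.

Lemma normal_pdf_affine a s t : 0 < s -> normal_pdf a s (a + s * t) * s = gauss_pdf t.
Proof.
move=> s0; rewrite gauss_pdfE normal_pdfE ?gt_eqF// /normal_fun.
have -> : - (a + s * t - a) ^+ 2 / (s ^+ 2 *+ 2) = - t ^+ 2 / 2.
  by field; rewrite gt_eqF.
rewrite mulrAC; congr (_ * _).
by rewrite normal_peakV// mulrAC mulVf ?mul1r// gt_eqF.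
Qed.

Lemma gauss_mean_pdf F a s : 0 < s -> continuous F -> (forall u, 0 <= F u) ->
  gauss_mean F a s = (\int[mu]_u (F u * normal_pdf a s u)%:E)%E.
Proof.
move=> s0 cF F0.
pose h t := a + s * t.
have dh t : is_derive t 1 h s.
  by apply: is_derive_eq; rewrite /GRing.scale/=; ring.
have h'E : h^`()%classic = cst s.
  by apply/funext => t; rewrite derive1E; case: (dh t).
rewrite (@increasing_ge0_integration_by_substitutionT _ h)//.
- apply: eq_integral => t _; rewrite h'E /= /h; congr EFin.
  by rewrite -(normal_pdf_affine a t s0) mulrA.
- by move=> t t' tt'; rewrite /h ltrD2l ltr_pM2l.
- by rewrite h'E => t; exact: cvg_cst.
- by rewrite h'E; exact: is_cvg_cst.
- by rewrite h'E; exact: is_cvg_cst.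
- apply: (cvg_comp (fun t => s * t) (fun y => a + y)); last exact: cvg_addrl_Ny.
  rewrite (_ : (fun t => s * t) = (fun t => t * s)); last by apply/funext => t; rewrite mulrC.
  by apply: gt0_cvgMlNy.
- apply: (cvg_comp (fun t => s * t) (fun y => a + y)); last exact: cvg_addrl.
  rewrite (_ : (fun t => s * t) = (fun t => t * s)); last by apply/funext => t; rewrite mulrC.
  by apply: gt0_cvgMly.
- by move=> t; apply: cvgM; [exact: cF|apply: continuous_normal_pdf; rewrite gt_eqF].
- by move=> t; rewrite mulr_ge0 ?normal_pdf_ge0.
Qed.

(** Disintegration of a pair of normal variables: given t standard, u is
    N(a + s t, x^2); conversely u is N(a, s^2 + x^2), and given u the variable t
    is normal with the posterior mean and deviation on the right.  The proof
    completes the square in t. *)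
Lemma normal_pdf_mix a s x t u : 0 < s -> 0 < x ->
  normal_pdf (a + s * t) x u * gauss_pdf t =
  normal_pdf a (Num.sqrt (s ^+ 2 + x ^+ 2)) u *
  normal_pdf (s * (u - a) / (s ^+ 2 + x ^+ 2))
             (x / Num.sqrt (s ^+ 2 + x ^+ 2)) t.
Proof.
move=> s0 x0; set r := Num.sqrt _.
have r2 : r ^+ 2 = s ^+ 2 + x ^+ 2.
  by rewrite sqr_sqrtr// addr_ge0 ?sqr_ge0.
have r0 : 0 < r by rewrite sqrtr_gt0 addr_gt0 ?exprn_gt0.
rewrite -r2 !normal_pdfE ?gt_eqF ?divr_gt0//.
rewrite /normal_fun.
rewrite [normal_peak x]normal_peakV// (@normal_peakV r)//.
rewrite (@normal_peakV (x / r)) ?divr_gt0// subr0 expr1n.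
rewrite mulrACA [RHS]mulrACA -!expRD; congr (_ * expR _).
  by field; rewrite !gt_eqF.
rewrite exprMn exprVn r2; field.
by rewrite (gt_eqF x0) -r2 gt_eqF// exprn_gt0.
Qed.

Lemma gauss_mean0 F a : gauss_mean F a 0 = (F a)%:E.
Proof.
rewrite /gauss_mean; under eq_integral do rewrite mul0r addr0 EFinM.
rewrite integralZl//=; last exact: integrable_normal_pdf.
by rewrite integral_normal_pdf mule1.
Qed.

Lemma gauss_meanN F a s : continuous F -> (forall u, 0 <= F u) ->
  gauss_mean F a (- s) = gauss_mean F a s.
Proof.
move=> cF F0.
rewrite /gauss_mean -[RHS]ge0_integral_opp.
- by apply: eq_integral => t _; rewrite gauss_pdfN mulrN mulNr.
- apply: continuous_measurable_fun => t; apply: cvgM; last exact: continuous_gauss_pdf.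
  apply: (cvg_comp (fun t => a + s * t) F); last exact: cF.
  by apply: cvgD; [exact: cvg_cst|apply: cvgM; [exact: cvg_cst|exact: cvg_id]].
- by move=> t; rewrite mulr_ge0 ?normal_pdf_ge0.
Qed.

Lemma measurable_gauss_mean F a s x : continuous F -> (forall u, 0 <= F u) ->
  measurable_fun setT (fun t => gauss_mean F (a + s * t) x).
Proof.
move=> cF F0; pose f (z : measurableTypeR R * measurableTypeR R) :=
  (F (a + s * z.1 + x * z.2) * gauss_pdf z.2)%:E.
apply: (@measurable_fun_fubini_tonelli_F _ _ (measurableTypeR R) (measurableTypeR R) R mu f).
  apply/measurable_EFinP; apply: measurable_funM.
    apply: measurableT_comp; first exact: continuous_measurable_fun.
    apply: measurable_funD; last exact: measurable_funM.
    by apply: measurable_funD => //; exact: measurable_funM.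
  apply: measurableT_comp => //; exact: measurable_normal_pdf.
by move=> z; rewrite lee_fin mulr_ge0 ?normal_pdf_ge0.
Qed.

(** A normal variable plus an independent normal variable is normal, with
    variances adding up: after exchanging the integrals, [normal_pdf_mix] makes
    the integral over t that of a probability density. *)
Lemma gauss_mean_conv F a s x : 0 <= s -> 0 <= x -> continuous F ->
  (forall u, 0 <= F u) ->
  (\int[mu]_t (gauss_mean F (a + s * t) x * (gauss_pdf t)%:E) =
   gauss_mean F a (Num.sqrt (s ^+ 2 + x ^+ 2)))%E.
Proof.
rewrite le_eqVlt => /predU1P[<- x0 cF F0|s0].
  under eq_integral do rewrite mul0r addr0.
  rewrite ge0_integralZl//=.
  - rewrite integral_normal_pdf mule1 expr0n add0r sqrtr_sqr ger0_norm//.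
  - by apply/measurable_EFinP; exact: measurable_normal_pdf.
  - by move=> t _; rewrite lee_fin normal_pdf_ge0.
  - by apply: integral_ge0 => t _; rewrite lee_fin mulr_ge0 ?normal_pdf_ge0.
rewrite le_eqVlt => /predU1P[<- cF F0|x0 cF F0].
  rewrite expr0n addr0 sqrtr_sqr gtr0_norm//; apply: eq_integral => t _.
  by rewrite gauss_mean0.
set r := Num.sqrt _.
have r0 : 0 < r by rewrite sqrtr_gt0 addr_gt0 ?exprn_gt0.
have mF : measurable_fun setT F by exact: continuous_measurable_fun.
rewrite (gauss_mean_pdf _ r0)//.
pose m u := s * (u - a) / (s ^+ 2 + x ^+ 2).
pose f (z : measurableTypeR R * measurableTypeR R) :=
  (F z.2 * normal_pdf a r z.2 * normal_pdf (m z.2) (x / r) z.1)%:E.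
transitivity (\int[mu]_t \int[mu]_u f (t, u))%E.
  apply: eq_integral => t _.
  rewrite gauss_mean_pdf//.
  rewrite -ge0_integralZr; last 4 first.
  - exact: measurableT.
  - by apply/measurable_EFinP; apply: measurable_funM => //; exact: measurable_normal_pdf.
  - by move=> u _; rewrite lee_fin mulr_ge0 ?normal_pdf_ge0.
  - by rewrite lee_fin normal_pdf_ge0.
  apply: eq_integral => u _; rewrite /f/= -EFinM; congr EFin.
  by rewrite -!mulrA normal_pdf_mix.
rewrite fubini_tonelli//; last 2 first.
- apply/measurable_EFinP; apply: measurable_funM.
    apply: measurable_funM; first exact: measurableT_comp.
    by apply: measurableT_comp => //; exact: measurable_normal_pdf.
  have ctr u t : normal_pdf (m u) (x / r) t = normal_pdf 0 (x / r) (t - m u).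
    by rewrite !normal_pdfE ?gt_eqF ?divr_gt0// (normal_fun_center (m u)).
  under eq_fun do rewrite ctr.
  apply: (measurableT_comp (measurable_normal_pdf 0 (x / r))).
  apply: measurable_funB => //; rewrite /m.
  apply: measurable_funM => //; apply: measurable_funM => //.
  exact: measurable_funB.
- by move=> z; rewrite lee_fin !mulr_ge0 ?normal_pdf_ge0.
apply: eq_integral => u _; rewrite /f/=.
under eq_integral do rewrite EFinM.
rewrite ge0_integralZl//=.
- by rewrite integral_normal_pdf mule1.
- by apply/measurable_EFinP; exact: measurable_normal_pdf.
- by move=> t _; rewrite lee_fin normal_pdf_ge0.
- by rewrite lee_fin mulr_ge0 ?normal_pdf_ge0.
Qed.

End gauss_mean.

(** * Functions with a convex second derivative *)

Section convex_second_derivative.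
Context {R : realType}.
Implicit Types (F : R -> R) (a c k l s t u v x y : R).

(** The derivatives F1 and F2 are explicit so that the class is visibly stable
    under affine substitutions and under adding quadratic polynomials. *)
Definition convex_second_derivative F F1 F2 : Prop :=
  [/\ forall t, is_derive t 1 F (F1 t), forall t, is_derive t 1 F1 (F2 t) &
      forall l u v, 0 <= l <= 1 ->
        F2 (l * u + (1 - l) * v) <= l * F2 u + (1 - l) * F2 v].

Lemma is_derive_continuous F F1 :
  (forall t, is_derive t 1 F (F1 t)) -> continuous F.
Proof.
by move=> dF t; apply: differentiable_continuous; apply/derivable1_diffP; case: (dF t).
Qed.

Lemma is_derive_mvt F F1 u v : (forall t, is_derive t 1 F (F1 t)) -> u < v ->
  exists2 c, u < c < v & F v - F u = F1 c * (v - u).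
Proof.
move=> dF uv.
have cF : {within `[u, v], continuous F}.
  by apply: continuous_subspaceT; exact: is_derive_continuous dF.
have [c] := MVT uv (fun t _ => dF t) cF.
by rewrite in_itv/= => cuv E; exists c.
Qed.

Lemma le_of_derive_sign F F1 c t : (forall u, is_derive u 1 F (F1 u)) ->
  (forall u, c < u < t -> 0 <= F1 u) -> (forall u, t < u < c -> F1 u <= 0) ->
  F c <= F t.
Proof.
move=> dF Fge Fle; rewrite -subr_ge0.
have [ct|tc|->] := ltgtP c t; last by rewrite subrr.
- have [u /Fge u0 ->] := is_derive_mvt dF ct.
  by rewrite mulr_ge0// subr_ge0 ltW.
- have [u /Fle u0 E] := is_derive_mvt dF tc.
  by rewrite -opprB E oppr_ge0 mulr_le0_ge0// subr_ge0 ltW.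
Qed.

(** F t is a convex function of t^2, and this is its tangent at t^2 = 1.  Indeed
    F1 - F1 1 * id vanishes at 0 and 1, and its derivative F2 - F1 1 changes from
    nonpositive to nonnegative at a point xi of ]0, 1[; so it is nonpositive on [0, 1]
    and nonnegative beyond 1. *)
Lemma even_quadratic_minorant F F1 F2 t :
  (forall u, is_derive u 1 F (F1 u)) -> (forall u, is_derive u 1 F1 (F2 u)) ->
  (forall u, F (- u) = F u) -> F1 0 = 0 ->
  (forall u v, 0 <= u -> u <= v -> F2 u <= F2 v) ->
  F 1 + F1 1 / 2 * (t ^+ 2 - 1) <= F t.
Proof.
move=> dF dF1 evF F10 F2nd; set k := F1 1.
have [xi /andP[xi0 xi1]] := is_derive_mvt dF1 (@ltr01 R).
rewrite F10 !subr0 mulr1 -/k => kE.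
have above u : 1 < u -> k * u <= F1 u.
  move=> u1; have [c /andP[c1 _]] := is_derive_mvt dF1 u1.
  have : k <= F2 c by rewrite kE F2nd ?(ltW xi0)// ltW// (lt_trans xi1).
  by rewrite -/k; nra.
have below u : 0 < u -> u < 1 -> F1 u <= k * u.
  move=> u0 u1; have [uxi|xiu] := leP u xi.
    have [c /andP[c0 cu]] := is_derive_mvt dF1 u0.
    have : F2 c <= k by rewrite kE F2nd ?(ltW c0)// ltW// (lt_le_trans cu).
    by rewrite F10; nra.
  have [c /andP[uc _]] := is_derive_mvt dF1 u1.
  have : k <= F2 c by rewrite kE F2nd ?(ltW xi0)// ltW// (lt_trans xiu).
  by rewrite -/k; nra.
wlog t0 : t / 0 <= t.
  move=> wl; have [t0|t0] := leP 0 t; first exact: wl.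
  by have := wl (- t); rewrite sqrrN evF; apply; rewrite oppr_ge0 ltW.
pose D u := F u - k / 2 * u ^+ 2.
have dD u : is_derive u 1 D (F1 u - k * u).
  by have := dF u => dFu; apply: is_derive_eq; rewrite /GRing.scale/=; field.
have : D 1 <= D t.
  apply: (le_of_derive_sign dD) => u /andP[ua ub].
    by rewrite subr_ge0 above.
  by rewrite subr_le0 below// (le_lt_trans t0).
rewrite /D; nra.
Qed.

Lemma is_derive_affine F y a x t : is_derive (a + x * t) 1 F y ->
  is_derive t 1 (fun s => F (a + x * s)) (x * y).
Proof.
move=> dF.
pose g s := a + x * s.
have dg : is_derive t 1 g x.
  by apply: is_derive_eq; rewrite /GRing.scale/=; ring.
by rewrite mulrC; exact: (@is_derive1_comp _ F g t y x dF dg).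
Qed.

(** Symmetrization makes any function with convex second derivative satisfy the
    hypotheses of [even_quadratic_minorant]: an even convex function, such as
    the second derivative G2 below, is nondecreasing on the positive reals. *)
Lemma symmetrized_quadratic_minorant F F1 F2 a x :
  convex_second_derivative F F1 F2 ->
  exists k, forall t, (F (a + x) + F (a - x)) / 2 + k * (t ^+ 2 - 1) <=
    (F (a + x * t) + F (a - x * t)) / 2.
Proof.
move=> [dF dF1 cvx].
pose G t := (F (a + x * t) + F (a + (- x) * t)) / 2.
pose G1 t := x * (F1 (a + x * t) - F1 (a + (- x) * t)) / 2.
pose G2 t := x ^+ 2 * (F2 (a + x * t) + F2 (a + (- x) * t)) / 2.
have dG t : is_derive t 1 G (G1 t).
  have d1 := is_derive_affine (dF (a + x * t)).
  have d2 := is_derive_affine (dF (a + - x * t)).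
  by apply: is_derive_eq; rewrite /G1 /GRing.scale/=; field.
have dG1 t : is_derive t 1 G1 (G2 t).
  have d1 := is_derive_affine (dF1 (a + x * t)).
  have d2 := is_derive_affine (dF1 (a + - x * t)).
  by apply: is_derive_eq; rewrite /G2 /GRing.scale/=; field.
exists (G1 1 / 2) => t.
have -> : (F (a + x) + F (a - x)) / 2 = G 1 by rewrite /G !mulr1.
have -> : (F (a + x * t) + F (a - x * t)) / 2 = G t by rewrite /G mulNr.
apply: (even_quadratic_minorant _ dG dG1).
- by move=> u; rewrite /G mulrNN mulrN -mulNr [X in X / 2]addrC.
- by rewrite /G1 !mulr0 subrr mulr0 mul0r.
move=> u v u0 uv; rewrite /G2 !mulNr.
have [v0|v0] := eqVneq v 0.
  by have -> : u = v by apply/le_anti; rewrite uv v0 u0.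
have {}v0 : 0 < v by rewrite lt0r v0 (le_trans u0).
(* The weight that writes u as a barycenter of v and - v. *)
pose l := (1 + u / v) / 2.
have l01 : 0 <= l <= 1.
  have : 0 <= u / v <= 1 by rewrite divr_ge0 ?(ltW v0)//= ler_pdivrMr// mul1r.
  by rewrite /l; lra.
have lE : l * v + (1 - l) * - v = u by rewrite /l; field; rewrite gt_eqF.
have := cvx l (a + x * v) (a - x * v) l01.
have -> : l * (a + x * v) + (1 - l) * (a - x * v) = a + x * u by rewrite -lE; ring.
have := cvx l (a - x * v) (a + x * v) l01.
have -> : l * (a - x * v) + (1 - l) * (a + x * v) = a - x * u by rewrite -lE; ring.
move=> h1 h2; have x2 := sqr_ge0 x.
by rewrite ler_wpM2r ?invr_ge0// ler_wpM2l//; lra.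
Qed.

Lemma second_derivative_ge0_chord F F1 F2 a x y :
  (forall u, is_derive u 1 F (F1 u)) -> (forall u, is_derive u 1 F1 (F2 u)) ->
  (forall u, 0 <= F2 u) -> `|y| <= 1 ->
  F (a + y * x) <= (1 + y) / 2 * F (a + x) + (1 - y) / 2 * F (a - x).
Proof.
move=> dF dF1 F20; rewrite ler_norml => /andP[y1 y2].
have F1nd u v : u <= v -> F1 u <= F1 v.
  move=> uv; apply: (le_of_derive_sign dF1) => // w.
  by move=> /andP[vw wu]; have := lt_trans vw wu; rewrite ltNge uv.
pose u := a + y * x.
have tangent v : F u + F1 u * (v - u) <= F v.
  pose H w := F w - F1 u * w.
  have dH (w : R) : is_derive w 1 H (F1 w - F1 u).
    by have := dF w => dFw; apply: is_derive_eq; rewrite /GRing.scale/=; ring.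
  suff : H u <= H v by rewrite /H; lra.
  apply: (le_of_derive_sign dH) => w /andP[w1 w2].
    by rewrite subr_ge0 F1nd// ltW.
  by rewrite subr_le0 F1nd// ltW.
have h1 : (1 + y) / 2 * (F u + F1 u * (a + x - u)) <= (1 + y) / 2 * F (a + x).
  by rewrite ler_wpM2l//; lra.
have h2 : (1 - y) / 2 * (F u + F1 u * (a - x - u)) <= (1 - y) / 2 * F (a - x).
  by rewrite ler_wpM2l//; lra.
apply: le_trans (lerD h1 h2); rewrite le_eqVlt; apply/orP; left; apply/eqP.
by rewrite -/u /u; field.
Qed.

Lemma second_derivative_minorant F F1 F2 m t :
  (forall u, is_derive u 1 F (F1 u)) -> (forall u, is_derive u 1 F1 (F2 u)) ->
  F1 0 = 0 -> (forall u, m <= F2 u) -> F 0 + m / 2 * t ^+ 2 <= F t.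
Proof.
move=> dF dF1 F10 mF2.
pose H u := F u - m / 2 * u ^+ 2; pose H1 u := F1 u - m * u.
have dH (u : R) : is_derive u 1 H (H1 u).
  by have dFu := dF u; apply: is_derive_eq; rewrite /H1 /GRing.scale/=; field.
have dH1 (u : R) : is_derive u 1 H1 (F2 u - m).
  by have dFu := dF1 u; apply: is_derive_eq; rewrite /GRing.scale/=; ring.
have H1nd u v : u <= v -> H1 u <= H1 v.
  move=> uv; apply: (le_of_derive_sign dH1) => w; first by rewrite subr_ge0.
  by move=> /andP[vw wu]; have := lt_trans vw wu; rewrite ltNge uv.
have H10 : H1 0 = 0 by rewrite /H1 F10 mulr0 subrr.
suff : H 0 <= H t by rewrite /H expr0n/= mulr0 subr0; lra.
by apply: (le_of_derive_sign dH) => u /andP[u1 u2]; rewrite -H10; apply: H1nd; exact: ltW.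
Qed.

Lemma convex_second_derivative_sub_quadratic F F1 F2 c k :
  convex_second_derivative F F1 F2 ->
  convex_second_derivative (fun t => F t - (c + k * t ^+ 2))
    (fun t => F1 t - 2 * k * t) (fun t => F2 t - 2 * k).
Proof.
move=> [dF dF1 cvx]; split.
- by move=> t; have d := dF t; apply: is_derive_eq; rewrite /GRing.scale/=; ring.
- by move=> t; have d := dF1 t; apply: is_derive_eq; rewrite /GRing.scale/=; ring.
- by move=> l u v l01; have := cvx l u v l01; lra.
Qed.

End convex_second_derivative.

Section C2_conv_facts.
Context {R : realType}.
Context (f : R -> R) (hf : C2_conv f).

Lemma C2_conv_convex_second_derivative :
  convex_second_derivative f f^`()%classic f^`(2)%classic.
Proof.
case: hf => evf df ddf cvx; split.
- by move=> t; rewrite derive1E; apply: DeriveDef => //; exact: df.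
- by move=> t; rewrite derive1nS/= derive1E; apply: DeriveDef => //; exact: ddf.
- move=> l u v /andP[l0 l1].
  by have := cvx (Itv01 l0 l1) u v (in_setT _) (in_setT _); rewrite !convRE.
Qed.

Lemma C2_conv_derive_odd t : f^`()%classic (- t) = - f^`()%classic t.
Proof.
case: hf => evf _ _ _; have [df _ _] := C2_conv_convex_second_derivative.
(* Differentiate f(- t) = f t, with - t seen as the affine map 0 + -1 * t. *)
have := is_derive_affine (df (0 + -1 * t)).
rewrite (_ : (fun s => f (0 + -1 * s)) = f); last first.
  by apply/funext => s; rewrite add0r mulN1r evf.
by move=> [_]; rewrite -derive1E add0r !mulN1r => ->; rewrite opprK.
Qed.

Lemma C2_conv_second_derive_even t : f^`(2)%classic (- t) = f^`(2)%classic t.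
Proof.
have [_ ddf _] := C2_conv_convex_second_derivative.
have := is_derive_affine (ddf (0 + -1 * t)).
rewrite (_ : (fun s => f^`()%classic (0 + -1 * s)) = - f^`()%classic); last first.
  by apply/funext => s; rewrite add0r mulN1r C2_conv_derive_odd.
have d := is_deriveN (ddf t).
move=> [_]; rewrite derive_val add0r !mulN1r => /oppr_inj ->.
by [].
Qed.

Lemma C2_conv_derive0 : f^`()%classic 0 = 0.
Proof. by have := C2_conv_derive_odd 0; rewrite oppr0; lra. Qed.

(** 0 is the midpoint of t and - t, where the even function f'' takes the same
    value. *)
Lemma C2_conv_second_derive_min t : f^`(2)%classic 0 <= f^`(2)%classic t.
Proof.
have [_ _ cvx] := C2_conv_convex_second_derivative.
have h : 0 <= (2^-1 : R) <= 1 by lra.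
have := cvx _ t (- t) h; rewrite C2_conv_second_derive_even.
have -> : 2^-1 * t + (1 - 2^-1) * - t = 0 by field.
by move: (f^`(2)%classic 0) (f^`(2)%classic t) => p q; lra.
Qed.

End C2_conv_facts.

(** * Replacing signs by normal variables *)

Section gaussian_step.
Context {R : realType}.
Notation mu := (@lebesgue_measure R).
Implicit Types (F : R -> R) (a b k s t u x : R).

Lemma measurable_affine_comp F b s : continuous F ->
  measurable_fun [set: R] (fun t : R => F (b + s * t)).
Proof.
move=> cF; apply: measurableT_comp; first exact: continuous_measurable_fun.
by apply: measurable_funD => //; exact: measurable_funM.
Qed.

Lemma gauss_mean_average F b b' s s' : continuous F -> (forall u, 0 <= F u) ->
  ((2^-1)%:E * (gauss_mean F b s + gauss_mean F b' s') =
   \int[mu]_t ((F (b + s * t) + F (b' + s' * t)) / 2 * gauss_pdf t)%:E)%E.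
Proof.
move=> cF F0.
have m c r : measurable_fun [set: R] (fun t => (F (c + r * t) * gauss_pdf t)%:E).
  apply/measurable_EFinP; apply: measurable_funM; last exact: measurable_normal_pdf.
  exact: measurable_affine_comp.
have p c r t : (0 <= (F (c + r * t) * gauss_pdf t)%:E)%E.
  by rewrite lee_fin mulr_ge0 ?normal_pdf_ge0.
transitivity (\int[mu]_t ((2^-1)%:E * ((F (b + s * t) * gauss_pdf t)%:E +
    (F (b' + s' * t) * gauss_pdf t)%:E)))%E; last first.
  by apply: eq_integral => t _; rewrite -EFinD -EFinM; congr EFin; ring.
rewrite ge0_integralZl//=; last by move=> t _; rewrite adde_ge0.
  by rewrite ge0_integralD//; [exact: (m b s)|exact: (m b' s')].
by apply: emeasurable_funD; [exact: (m b s)|exact: (m b' s')].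
Qed.

Lemma gaussian_integral_quadratic A B : 0 <= A -> 0 <= B ->
  (\int[mu]_t ((A + B * t ^+ 2) * gauss_pdf t)%:E = (A + B)%:E)%E.
Proof.
move=> A0 B0.
have mp : measurable_fun [set: R] (fun t : R => (gauss_pdf t)%:E).
  by apply/measurable_EFinP; exact: measurable_normal_pdf.
have mp2 : measurable_fun [set: R] (fun t : R => (t ^+ 2 * gauss_pdf t)%:E).
  apply/measurable_EFinP; apply: measurable_funM; last exact: measurable_normal_pdf.
  exact: measurable_funX.
have p0 t : (0 <= (gauss_pdf t)%:E :> \bar R)%E by rewrite lee_fin normal_pdf_ge0.
have p20 t : (0 <= (t ^+ 2 * gauss_pdf t)%:E)%E.
  by rewrite lee_fin mulr_ge0 ?sqr_ge0 ?normal_pdf_ge0.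
transitivity (\int[mu]_t (A%:E * (gauss_pdf t)%:E + B%:E * (t ^+ 2 * gauss_pdf t)%:E))%E.
  by apply: eq_integral => t _; rewrite -!EFinM -EFinD; congr EFin; ring.
rewrite ge0_integralD//=.
- rewrite !ge0_integralZl//; rewrite ?lee_fin//.
  by rewrite second_moment_gauss_pdf integral_normal_pdf !mule1.
- by move=> t _; rewrite mule_ge0.
- exact: measurable_funeM.
- by move=> t _; rewrite mule_ge0.
- exact: measurable_funeM.
Qed.

(** Integrate the tangent inequality of [symmetrized_quadratic_minorant]: its
    quadratic term has mean zero since the second moment is 1. *)
Lemma rademacher_le_gauss_mean F F1 F2 a x :
  convex_second_derivative F F1 F2 -> (forall u, 0 <= F u) ->
  (((F (a + x) + F (a - x)) / 2)%:E <= gauss_mean F a x)%E.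
Proof.
move=> cvx F0.
have cF : continuous F by case: cvx => dF _ _; exact: is_derive_continuous dF.
have [k kF] := symmetrized_quadratic_minorant a x cvx.
set c := _ / 2 in kF *.
have c0 : 0 <= c by rewrite divr_ge0 ?addr_ge0.
(* The slope k has no definite sign; its negative and positive parts are put on
   opposite sides so that only nonnegative functions are integrated. *)
pose kp := Num.max k 0; pose kn := Num.max (- k) 0.
have kp0 : 0 <= kp by rewrite le_max lexx orbT.
have kn0 : 0 <= kn by rewrite le_max lexx orbT.
have kE : k = kp - kn.
  by rewrite /kp /kn; case: (leP k 0) => k0; case: (leP (- k) 0) => k0'; lra.
have -> : gauss_mean F a x =
    (\int[mu]_t ((F (a + x * t) + F (a + - x * t)) / 2 * gauss_pdf t)%:E)%E.
  rewrite -gauss_mean_average// gauss_meanN// -mule2n -mule_natl muleA -EFinM.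
  by rewrite mulVf// mul1e.
rewrite -(@leeD2rE _ (kp + kn)%:E)// -EFinD.
rewrite -[X in (_ <= _ + X)%E](gaussian_integral_quadratic kp0 kn0).
rewrite -ge0_integralD//=; last 4 first.
- by move=> t _; rewrite lee_fin mulr_ge0 ?normal_pdf_ge0// divr_ge0// addr_ge0.
- apply/measurable_EFinP; apply: measurable_funM; last exact: measurable_normal_pdf.
  by apply: measurable_funM => //; apply: measurable_funD; exact: measurable_affine_comp.
- move=> t _; rewrite lee_fin mulr_ge0 ?normal_pdf_ge0// addr_ge0//.
  by rewrite mulr_ge0 ?sqr_ge0.
- apply/measurable_EFinP; apply: measurable_funM; last exact: measurable_normal_pdf.
  by apply: measurable_funD => //; apply: measurable_funM => //; exact: measurable_funX.
have -> : (c + (kp + kn))%:E = (\int[mu]_t ((c + kn + kp * t ^+ 2) * gauss_pdf t)%:E)%E.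
  by rewrite gaussian_integral_quadratic ?addr_ge0//; congr EFin; ring.
apply: ge0_le_integral => //=.
- move=> t _; rewrite lee_fin mulr_ge0 ?normal_pdf_ge0// addr_ge0 ?addr_ge0//.
  by rewrite mulr_ge0 ?sqr_ge0.
- apply/measurable_EFinP; apply: measurable_funM; last exact: measurable_normal_pdf.
  by apply: measurable_funD => //; apply: measurable_funM => //; exact: measurable_funX.
- apply/measurable_EFinP; apply: measurable_funD.
    apply: measurable_funM; last exact: measurable_normal_pdf.
    by apply: measurable_funM => //; apply: measurable_funD; exact: measurable_affine_comp.
  apply: measurable_funM; last exact: measurable_normal_pdf.
  by apply: measurable_funD => //; apply: measurable_funM => //; exact: measurable_funX.
- move=> t _; rewrite -EFinD lee_fin -mulrDl ler_wpM2r ?normal_pdf_ge0//.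
  by have := kF t; rewrite kE mulNr; lra.
Qed.

End gaussian_step.

Section signed_mix.
Context {R : realType}.
Implicit Types (F : R -> R) (n : nat) (a b c k t u : R).

(** The mean of F (a + sum of s i * x i) over independent signs s i of means
    y i (the boolean true stands for the sign -1).  For y = 0 it is the plain
    average over all signs. *)
Definition signed_mix n (y x : 'I_n -> R) F a : R :=
  \sum_(s : {ffun 'I_n -> bool})
    (\prod_(i < n) ((1 + (-1) ^+ s i * y i) / 2)) *
    F (a + \sum_(i < n) (-1) ^+ s i * x i).

Lemma signed_mix0 (y x : 'I_0 -> R) F a : signed_mix y x F a = F a.
Proof.
rewrite /signed_mix (big_pred1 [ffun=> true]) => [|s].
  by rewrite !big_ord0 mul1r addr0.
by apply/esym/eqP/ffunP => -[].
Qed.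

Lemma signed_mixS n (y x : 'I_n.+1 -> R) F a :
  let y' i := y (lift ord0 i) in let x' i := x (lift ord0 i) in
  signed_mix y x F a =
    (1 + y ord0) / 2 * signed_mix y' x' F (a + x ord0) +
    (1 - y ord0) / 2 * signed_mix y' x' F (a - x ord0).
Proof.
move=> y' x'.
pose ext (p : bool * {ffun 'I_n -> bool}) : {ffun 'I_n.+1 -> bool} :=
  [ffun i => if unlift ord0 i is Some j then p.2 j else p.1].
have ext0 p : ext p ord0 = p.1 by rewrite ffunE unlift_none.
have extS p i : ext p (lift ord0 i) = p.2 i by rewrite ffunE liftK.
rewrite /signed_mix (reindex ext); last first.
  exists (fun s : {ffun 'I_n.+1 -> bool} =>
    (s ord0, [ffun j : 'I_n => s (lift ord0 j)])) => [[b s]|s] _.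
    by congr pair; rewrite ?ext0//; apply/ffunP => j; rewrite ffunE extS.
  apply/ffunP => i; rewrite ffunE; case: unliftP => [j ->|->] //=.
  by rewrite ffunE.
pose G (b : bool) (s : {ffun 'I_n -> bool}) := ((1 + (-1) ^+ b * y ord0) / 2) *
  ((\prod_(i < n) ((1 + (-1) ^+ s i * y' i) / 2)) *
   F (a + (-1) ^+ b * x ord0 + \sum_(i < n) (-1) ^+ s i * x' i)).
transitivity (\sum_(p : bool * {ffun 'I_n -> bool}) G p.1 p.2).
  apply: eq_bigr => p _; rewrite /G 2!big_ord_recl ext0 mulrA addrA.
  by congr (_ * _ * F (_ + _)); apply: eq_bigr => i _; rewrite extS.
rewrite -(pair_bigA _ G) big_bool/= /G -!mulr_sumr addrC.
by rewrite !expr0 expr1 !mul1r !mulN1r.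
Qed.

Lemma le_signed_mix n (y x : 'I_n -> R) F a : (forall i, `|y i| <= 1) ->
  (forall i b, F (b + y i * x i) <=
    (1 + y i) / 2 * F (b + x i) + (1 - y i) / 2 * F (b - x i)) ->
  F (a + \sum_(i < n) y i * x i) <= signed_mix y x F a.
Proof.
elim: n => [|n IHn] in y x a *; first by rewrite signed_mix0 big_ord0 addr0.
move=> y1 chord; rewrite signed_mixS big_ord_recl [_ * _ + _]addrC addrA.
apply: le_trans (chord _ _) _.
have := y1 ord0; rewrite ler_norml => /andP[y0l y0u].
apply: lerD; (apply: ler_wpM2l; first by lra);
  by rewrite addrAC; apply: IHn => // i; exact: chord.
Qed.

Lemma signed_mix_eq n (y x : 'I_n -> R) F a :
  (forall i, y i = 1 \/ y i = -1) ->
  signed_mix y x F a = F (a + \sum_(i < n) y i * x i).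
Proof.
elim: n => [|n IHn] in y x a *; first by rewrite signed_mix0 big_ord0 addr0.
move=> y1; rewrite signed_mixS !IHn ?big_ord_recl//.
by case: (y1 ord0) => ->; rewrite ?subrr ?opprK ?mul1r ?mulN1r ?mul0r ?addr0 ?add0r
   ?addrA ?divff ?mul1r//; congr (F _); ring.
Qed.

Lemma signed_mix_sub_quadratic n (x : 'I_n -> R) F a c k :
  signed_mix (fun=> 0) x (fun t => F t - (c + k * t ^+ 2)) a =
  signed_mix (fun=> 0) x F a - (c + k * (a ^+ 2 + \sum_(i < n) x i ^+ 2)).
Proof.
elim: n => [|n IHn] in x a *; first by rewrite !signed_mix0 big_ord0 addr0.
by rewrite !signed_mixS !IHn big_ord_recl; field.
Qed.

(** The Gaussian comparison for n signs, by induction: the last n signs are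
    replaced by one normal variable of deviation r, then the first sign by an
    independent normal variable of deviation |x ord0|, and the two are merged by
    [gauss_mean_conv]. *)
Lemma signed_mix_le_gauss_mean n (x : 'I_n -> R) F F1 F2 a :
  convex_second_derivative F F1 F2 -> (forall u, 0 <= F u) ->
  ((signed_mix (fun=> 0) x F a)%:E <=
    gauss_mean F a (Num.sqrt (\sum_(i < n) x i ^+ 2)))%E.
Proof.
move=> cvx F0.
have cF : continuous F by case: cvx => dF _ _; exact: is_derive_continuous dF.
elim: n => [|n IHn] in x a *.
  by rewrite signed_mix0 big_ord0 sqrtr0 gauss_mean0.
set r := Num.sqrt (\sum_(i < n) x (lift ord0 i) ^+ 2).
have r2 : r ^+ 2 = \sum_(i < n) x (lift ord0 i) ^+ 2.
  by rewrite sqr_sqrtr// sumr_ge0// => i _; exact: sqr_ge0.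
rewrite signed_mixS big_ord_recl -r2 (addrC (x ord0 ^+ 2)).
rewrite addr0 subr0 -mulrDr mul1r EFinM EFinD.
apply: (@le_trans _ _ ((2^-1)%:E *
    (gauss_mean F (a + x ord0) r + gauss_mean F (a - x ord0) r))%E).
  by rewrite lee_pmul2l//; apply: leeD; exact: IHn.
rewrite gauss_mean_average// -(real_normK (num_real (x ord0))).
rewrite -gauss_mean_conv ?sqrtr_ge0//.
apply: ge0_le_integral => //.
- by move=> t _; rewrite lee_fin mulr_ge0 ?normal_pdf_ge0// divr_ge0// addr_ge0.
- apply/measurable_EFinP; apply: measurable_funM; last exact: measurable_normal_pdf.
  by apply: measurable_funM => //; apply: measurable_funD; exact: measurable_affine_comp.
- apply: emeasurable_funM; first exact: measurable_gauss_mean.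
  by apply/measurable_EFinP; exact: measurable_normal_pdf.
move=> t _; rewrite EFinM lee_wpmul2r ?lee_fin ?normal_pdf_ge0//.
have -> : F (a + x ord0 + r * t) + F (a - x ord0 + r * t) =
    F (a + r * t + `|x ord0|) + F (a + r * t - `|x ord0|).
  rewrite (addrAC a) (addrAC a _ (r * t)).
  have [x0|x0] := leP 0 (x ord0); first by rewrite ger0_norm.
  by rewrite ltr0_norm// opprK; exact: addrC.
exact: (rademacher_le_gauss_mean _ _ cvx F0).
Qed.

End signed_mix.

(** * Means of functions of independent bounded variables *)

Section truncated_weights.
Context {R : realType}.

(** The weight (1 + y) / 2 of the sign 1, or (1 - y) / 2 of the sign -1, in the
    decomposition of y in [-1, 1].  It is truncated to [0, 1] because the random
    variables stay in [-1, 1] only almost surely. *)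
Definition sign_weight (b : bool) (y : R) : R :=
  Num.min 1 (Num.max 0 ((1 + (-1) ^+ b * y) / 2)).

Lemma sign_weight_itv b y : 0 <= sign_weight b y <= 1.
Proof. by rewrite /sign_weight ge_min lexx le_min ler01 le_max lexx. Qed.

Lemma measurable_sign_weight b : measurable_fun [set: R] (sign_weight b).
Proof.
apply: measurable_minr => //; apply: measurable_maxr => //.
apply: measurable_funM => //; apply: measurable_funD => //.
Qed.

Lemma sign_weightE b y : `|y| <= 1 -> sign_weight b y = (1 + (-1) ^+ b * y) / 2.
Proof.
rewrite ler_norml => /andP[y1 y2].
rewrite /sign_weight max_r; last by case: b; rewrite ?expr0 ?expr1; lra.
by rewrite min_r//; case: b; rewrite ?expr0 ?expr1; lra.
Qed.

End truncated_weights.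

Section independent_sum.
Context d (T : measurableType d) (R : realType) (P : probability T R).
Context (n : nat) (X : 'I_n -> {RV P >-> R}) (x : 'I_n -> R) (f : R -> R).

Definition sign_weight_mix w := \sum_(s : {ffun 'I_n -> bool})
  (\prod_(i < n) sign_weight (s i) (X i w)) *
  f (\sum_(i < n) (-1) ^+ s i * x i).

Lemma sign_weight_mixE w : (forall i, `|X i w| <= 1) ->
  sign_weight_mix w = signed_mix (fun i => X i w) x f 0.
Proof.
move=> X1; apply: eq_bigr => s _; rewrite add0r; congr (_ * _).
by apply: eq_bigr => i _; rewrite sign_weightE.
Qed.

Let mweight i b : measurable_fun [set: T] (fun w => sign_weight b (X i w)).
Proof. by apply: measurableT_comp => //; exact: measurable_sign_weight. Qed.

Let mprod (s : {ffun 'I_n -> bool}) :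
  measurable_fun [set: T] (fun w => \prod_(i < n) sign_weight (s i) (X i w)).
Proof. by apply: measurable_prod => i _; exact: mweight. Qed.

Lemma measurable_sign_weight_mix : measurable_fun [set: T] sign_weight_mix.
Proof. by apply: measurable_sum => s; exact: measurable_funM. Qed.

(** Each product of weights has mean 2^-n by independence. *)
Lemma integral_sign_weight_mix : mutually_independent X ->
  (forall i b, \int[P]_w (sign_weight b (X i w))%:E = (2^-1)%:E)%E ->
  (\int[P]_w (sign_weight_mix w)%:E = (signed_mix (fun=> 0) x f 0)%:E)%E.
Proof.
move=> Xind Ehalf.
have int01 (g : T -> R) : measurable_fun [set: T] g -> (forall w, 0 <= g w <= 1) ->
    P.-integrable [set: T] (EFin \o g).
  move=> mg g01; apply: measurable_bounded_integrable => //.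
    by apply: le_lt_trans (probability_le1 P measurableT) _; exact: ltry.
  exists 1; split; first exact: num_real.
  move=> M M1 w _ /=; have /andP[g0 g1] := g01 w.
  by rewrite ger0_norm// (le_trans g1)// ltW.
have iprod (s : {ffun 'I_n -> bool}) : P.-integrable [set: T]
    (EFin \o (fun w => \prod_(i < n) sign_weight (s i) (X i w))).
  apply: int01 => // w; apply/andP; split.
    by apply: prodr_ge0 => i _; case/andP: (sign_weight_itv (s i) (X i w)).
  by apply: prodr_ile1 => i _; exact: sign_weight_itv.
under eq_integral do rewrite -sumEFin.
rewrite integral_sum//; last first.
  move=> s; under eq_fun do rewrite EFinM.
  by apply: integrableZr => //; exact: iprod.
rewrite -sumEFin; apply: eq_bigr => s _.
under eq_integral do rewrite EFinM.
rewrite integralZr//; last exact: iprod.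
rewrite (expectation_prod_independent (h := fun i => sign_weight (s i)) Xind); last 2 first.
- by move=> i; exact: measurable_sign_weight.
- by move=> i y; exact: sign_weight_itv.
rewrite add0r EFinM; congr (_ * _)%E.
rewrite -prodEFin; apply: eq_bigr => i _.
by rewrite Ehalf mulr0 addr0 mul1r.
Qed.

End independent_sum.

Section sign_weight_expectation.
Context d (T : measurableType d) (R : realType) (P : probability T R).
Implicit Type X : {RV P >-> R}.

Lemma measurable_level X (c : R) : measurable [set w | X w = c].
Proof.
have mX : measurable_fun [set: T] X by [].
by have := mX measurableT [set c] (measurable_set1 c); rewrite setTI.
Qed.

Lemma rademacher_ae X : rademacher X -> {ae P, forall w, X w = 1 \/ X w = -1}.
Proof.
move=> [X1 XN1].
have mX := measurable_level X.
pose A := [set w | X w = 1] `|` [set w | X w = -1].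
have mA : measurable A by exact: measurableU.
have PA : P A = 1%E.
  rewrite measureU//.
    by rewrite [X in (X + _)%E]X1 [X in (_ + X)%E]XN1 -EFinD; congr EFin; field.
  by apply/seteqP; split=> // w /= [->] /eqP; rewrite -subr_eq0 opprK gt_eqF.
exists (~` A); split; first exact: measurableC.
  by rewrite probability_setC// PA subee.
by move=> w /= nw Aw; apply: nw.
Qed.

Lemma rademacher_sign_weight X b : rademacher X ->
  (\int[P]_w (sign_weight b (X w))%:E = (2^-1)%:E)%E.
Proof.
move=> rX; have aeX := rademacher_ae rX.
have mX := measurable_level X.
transitivity (\int[P]_w (\1_[set w | X w = (-1) ^+ b] w : R)%:E)%E.
  apply: ae_eq_integral => //.
  - by apply/measurable_EFinP; apply: measurableT_comp => //; exact: measurable_sign_weight.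
  - by apply/measurable_EFinP; exact: measurable_indic.
  - have n1 : (1 == -1 :> R) = false.
      by apply/negbTE; rewrite -subr_eq0 opprK gt_eqF.
    apply: filterS aeX => w Xw _; rewrite indicE.
    have -> : (w \in [set w | X w = (-1) ^+ b]) = (X w == (-1) ^+ b).
      by apply/idP/eqP => [/set_mem|?]; rewrite ?inE.
    congr EFin; rewrite sign_weightE; last by case: Xw => ->; rewrite ?normrN normr1.
    by case: Xw => ->; case: b; rewrite ?expr1 ?expr0 ?n1 ?[-1 == 1]eq_sym ?n1 ?eqxx /=;
      field.
rewrite integral_indic// setIT.
by case: rX => X1 XN1; case: b; rewrite ?expr0 ?expr1.
Qed.

Lemma centered_sign_weight X b : ('E_P[X] = 0)%E ->
  {ae P, forall w, `|X w| <= 1} ->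
  (\int[P]_w (sign_weight b (X w))%:E = (2^-1)%:E)%E.
Proof.
move=> EX X1.
have mX : measurable_fun [set: T] (EFin \o X) by exact/measurable_EFinP.
have iX : P.-integrable [set: T] (EFin \o X).
  apply/integrableP; split => //.
  apply: (@le_lt_trans _ _ (1 * P setT)%E).
    apply: integral_le_bound => //.
    by apply: filterS X1 => w Xw _; rewrite /= lee_fin.
  by rewrite mul1e; apply: le_lt_trans (probability_le1 P measurableT) _; exact: ltry.
have ic (c : R) : P.-integrable [set: T] (EFin \o cst c).
  exact: finite_measure_integrable_cst.
transitivity (\int[P]_w ((2^-1)%:E + ((-1) ^+ b / 2)%:E * (X w)%:E))%E.
  apply: ae_eq_integral => //.
  - by apply/measurable_EFinP; apply: measurableT_comp => //; exact: measurable_sign_weight.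
  - by apply: emeasurable_funD => //; exact: measurable_funeM.
  apply: filterS X1 => w Xw _; rewrite sign_weightE// -EFinM -EFinD.
  by congr EFin; field.
rewrite integralD//; last 2 first.
- exact: (ic 2^-1).
- exact: integrableZl.
rewrite integralZl//; move: EX; rewrite unlock => ->.
by rewrite mule0 adde0 integral_cst// [X in (_ * X)%E]probability_setT mule1.
Qed.

End sign_weight_expectation.

(** * Comparison with the standard normal variable *)

(** Additivity of the integral when u may have infinite mean: then the positive
    part of u + v has infinite mean too, while its negative part is dominated by
    |v|. *)
Lemma integralD_ge0_integrable d (T : measurableType d) (R : realType)
    (mu : {measure set T -> \bar R}) (u v : T -> R) :
  measurable_fun [set: T] u -> (forall w, 0 <= u w) ->
  mu.-integrable [set: T] (EFin \o v) ->
  (\int[mu]_w (u w + v w)%:E = \int[mu]_w (u w)%:E + \int[mu]_w (v w)%:E)%E.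
Proof.
move=> meas_u u0 iv.
have mv : measurable_fun [set: T] v.
  by apply/measurable_EFinP; case/integrableP: iv.
have [iu|niu] := pselect (mu.-integrable [set: T] (EFin \o u)).
  by under eq_integral do rewrite EFinD; rewrite integralD.
have intu : (\int[mu]_w (u w)%:E = +oo)%E.
  apply: contra_notP niu => /eqP nu; apply/integrableP; split.
    exact/measurable_EFinP.
  under eq_integral do rewrite /= ger0_norm//.
  by rewrite ltey.
have intv : (\int[mu]_w `|v w|%:E < +oo)%E by case/integrableP: iv.
have vfin : (\int[mu]_w (v w)%:E)%E \is a fin_num by exact: integrable_fin_num.
rewrite intu addye; last by move: vfin; rewrite fin_numE => /andP[].
pose g w := (u w + v w)%:E.
have mg : measurable_fun [set: T] g.
  by apply/measurable_EFinP; exact: measurable_funD.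
rewrite integralE.
have gneg : (\int[mu]_w g^\- w < +oo)%E.
  apply: le_lt_trans intv; apply: ge0_le_integral => //.
  - exact: measurable_funeneg.
  - by apply/measurable_EFinP; exact: measurableT_comp.
  move=> w _; rewrite funenegE /g -EFinN -EFin_max lee_fin ge_max normr_ge0 andbT.
  by have := ler_norm (- v w); rewrite normrN; have := u0 w; lra.
have gpos : (\int[mu]_w g^\+ w = +oo)%E.
  apply/eqP; rewrite eq_le leey/= leNgt; apply/negP => gpos.
  suff : (\int[mu]_w (u w)%:E < +oo)%E by rewrite intu ltxx.
  apply: (@le_lt_trans _ _ (\int[mu]_w (g^\+ w + `|v w|%:E))%E).
    apply: ge0_le_integral => //.
    - by move=> w _; rewrite lee_fin.
    - exact/measurable_EFinP.
    - apply: emeasurable_funD; first exact: measurable_funepos.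
      by apply/measurable_EFinP; exact: measurableT_comp.
    move=> w _; rewrite funeposE /g -EFin_max -EFinD lee_fin.
    have : u w + v w <= Num.max (u w + v w) 0 by rewrite le_max lexx.
    by have := ler_norm (- v w); rewrite normrN; lra.
  rewrite ge0_integralD//; last 2 first.
  - exact: measurable_funepos.
  - by apply/measurable_EFinP; exact: measurableT_comp.
  exact: lte_add_pinfty.
have : (- \int[mu]_w g^\- w)%E \is a fin_num.
  by rewrite fin_numN ge0_fin_numE// integral_ge0.
by rewrite gpos fin_numE => /andP[gN _]; rewrite addye.
Qed.

Lemma standard_normal_ge0_expectation d (T : measurableType d) (R : realType)
    (P : probability T R) (Z : {RV P >-> R}) (g : R -> R) :
  standard_normal Z -> continuous g -> (forall t, 0 <= g t) ->
  (\int[P]_w (g (Z w))%:E = gauss_mean g 0 1)%E.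
Proof.
move=> nZ cg g0.
have mg : measurable_fun [set: R] g by exact: continuous_measurable_fun.
have mZ : measurable_fun [set: T] Z by [].
transitivity (\int[normal_prob 0 1]_y (g y)%:E)%E.
  rewrite -(@ge0_integral_density _ _ T (measurableTypeR R) R Z mZ P
    (normal_prob 0 1) (cst 1) g)//.
    by apply: eq_integral => w _; rewrite mulr1.
  move=> B mB; rewrite /= integral_cst ?mul1e; first exact: nZ.
  by have := mZ measurableT B mB; rewrite setTI.
rewrite integral_normal_prob//; apply: eq_integral => t _.
by rewrite add0r mul1r.
Qed.

Lemma standard_normal_quadratic d (T : measurableType d) (R : realType)
    (P : probability T R) (Z : {RV P >-> R}) (c k : R) :
  standard_normal Z ->
  P.-integrable [set: T] (fun w => (c + k * Z w ^+ 2)%:E) /\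
  (\int[P]_w (c + k * Z w ^+ 2)%:E = (c + k)%:E)%E.
Proof.
move=> nZ.
have Z2 : (\int[P]_w (Z w ^+ 2)%:E = 1)%E.
  rewrite (@standard_normal_ge0_expectation _ _ _ _ _ (fun t : R => t ^+ 2) nZ).
  - rewrite /gauss_mean -second_moment_gauss_pdf.
    by apply: eq_integral => t _; rewrite add0r mul1r.
  - exact: exprn_continuous.
  - by move=> t; exact: sqr_ge0.
have mZ : measurable_fun [set: T] Z by [].
have iZ2 : P.-integrable [set: T] (EFin \o (fun w => Z w ^+ 2)).
  apply/integrableP; split.
    by apply/measurable_EFinP; exact: measurable_funX.
  under eq_integral do rewrite /= ger0_norm ?sqr_ge0//.
  by rewrite Z2 ltry.
have ikZ2 : P.-integrable [set: T] (fun w => k%:E * (Z w ^+ 2)%:E)%E.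
  exact: integrableZl.
have ic : P.-integrable [set: T] (EFin \o cst c).
  exact: finite_measure_integrable_cst.
have qE : (fun w => (c + k * Z w ^+ 2)%:E) =
    ((EFin \o cst c) \+ (fun w => k%:E * (Z w ^+ 2)%:E))%E.
  by apply/funext => w; rewrite EFinD EFinM.
split; first by rewrite qE; exact: integrableD.
rewrite qE integralD//= integral_cst// [X in (_ * X)%E]probability_setT mule1.
by rewrite integralZl// Z2 mule1 EFinD.
Qed.

(** Subtracting from f its quadratic minorant c + k * t ^+ 2 makes it nonnegative
    and keeps the second derivative convex; the minorant has mean c + k both
    over the signs and under the normal law. *)
Lemma signed_mix_le_standard_normal (R : realType) (n : nat) (x : 'I_n -> R)
    d (T : measurableType d) (P : probability T R) (Z : {RV P >-> R})
    (f : R -> R) :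
  \sum_(i < n) x i ^+ 2 = 1 -> standard_normal Z -> C2_conv f ->
  ((signed_mix (fun=> 0) x f 0)%:E <= \int[P]_w (f (Z w))%:E)%E.
Proof.
move=> x1 nZ hf.
have cvx := C2_conv_convex_second_derivative hf.
pose c := f 0; pose k := f^`(2)%classic 0 / 2.
pose g t := f t - (c + k * t ^+ 2).
have gcvx := convex_second_derivative_sub_quadratic c k cvx.
have cg : continuous g by case: gcvx => dg _ _; exact: is_derive_continuous dg.
have g0 t : 0 <= g t.
  rewrite subr_ge0; case: cvx => df ddf _.
  apply: (second_derivative_minorant _ df ddf (C2_conv_derive0 hf)) => u.
  exact: C2_conv_second_derive_min.
have [iq Eq] := standard_normal_quadratic c k nZ.
have mZ : measurable_fun [set: T] Z by [].
have -> : (\int[P]_w (f (Z w))%:E =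
    \int[P]_w (g (Z w) + (c + k * Z w ^+ 2))%:E)%E.
  by apply: eq_integral => w _; rewrite subrK.
rewrite integralD_ge0_integrable//; last first.
  by apply: measurableT_comp => //; exact: continuous_measurable_fun.
rewrite Eq (standard_normal_ge0_expectation nZ cg g0).
have := signed_mix_le_gauss_mean x 0 gcvx g0.
rewrite x1 sqrtr1 signed_mix_sub_quadratic x1 expr0n add0r mulr1 EFinB.
by rewrite leeBlDr.
Qed.

Theorem corollary4p4 (R : realType) (n : nat) (x : 'I_n -> R)
    (hx : \sum_(i < n) x i ^+ 2 = 1)
    (d0 : measure_display) (T0 : measurableType d0) (P0 : probability T0 R)
    (xi1 : {RV P0 >-> R}) (hxi1 : standard_normal xi1)
    (d1 : measure_display) (T1 : measurableType d1) (P1 : probability T1 R)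
    (eps : 'I_n -> {RV P1 >-> R})
    (heps_indep : mutually_independent eps)
    (heps : forall i, rademacher (eps i))
    (f : R -> R) (hf : C2_conv f) :
  ('E_P1[fun w => f (\sum_(i < n) eps i w * x i)%R]
     <= 'E_P0[fun w => f (xi1 w)])%E
  /\
  (C2_up_conv f ->
   forall (d2 : measure_display) (T2 : measurableType d2)
     (P2 : probability T2 R) (eta : 'I_n -> {RV P2 >-> R}),
     mutually_independent eta ->
     (forall i, ('E_P2[eta i] = 0)%E) ->
     (forall i, {ae P2, forall w, `|eta i w| <= 1}) ->
     ('E_P2[fun w => f (\sum_(i < n) eta i w * x i)%R]
        <= 'E_P0[fun w => f (xi1 w)])%E).
Proof.
have [df ddf cvx] := C2_conv_convex_second_derivative hf.
have cf : continuous f by exact: is_derive_continuous df.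
have mfS d (T : measurableType d) (P : probability T R) (X : 'I_n -> {RV P >-> R}) :
    measurable_fun [set: T] (fun w => f (\sum_(i < n) X i w * x i)).
  apply: measurableT_comp; first exact: continuous_measurable_fun.
  by apply: measurable_sum => i; exact: measurable_funM.
have expectationE d (T : measurableType d) (P : probability T R) (X : T -> R) :
    ('E_P[X] = \int[P]_w (X w)%:E)%E by rewrite unlock.
have norm := signed_mix_le_standard_normal hx hxi1 hf.
rewrite (expectationE _ _ P0); split; rewrite ?(expectationE _ _ P1); first (apply: le_trans norm).
  have half i b := rademacher_sign_weight b (heps i).
  rewrite -(integral_sign_weight_mix x f heps_indep half) le_eqVlt; apply/orP; left; apply/eqP.
  apply: ae_eq_integral => //.
  - by apply/measurable_EFinP; exact: (mfS _ _ _ eps).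
  - by apply/measurable_EFinP; exact: measurable_sign_weight_mix.
  have ae1 : {ae P1, forall w, forall i, eps i w = 1 \/ eps i w = -1}.
    by apply: filter_forall => i; exact: rademacher_ae.
  apply: filterS ae1 => w w1 _; rewrite sign_weight_mixE; last first.
    by move=> i; case: (w1 i) => ->; rewrite ?normrN normr1.
  by rewrite signed_mix_eq// add0r.
move=> [_ f00 f20] d2 T2 P2 eta eta_ind eta0 eta1; apply: le_trans norm.
rewrite (expectationE _ _ P2).
have half i b := centered_sign_weight b (eta0 i) (eta1 i).
rewrite -(integral_sign_weight_mix x f eta_ind half).
have f2 t : 0 <= f^`(2)%classic t.
  exact: le_trans f20 (C2_conv_second_derive_min hf t).
have fge0 t : 0 <= f t.
  have := second_derivative_minorant t df ddf (C2_conv_derive0 hf) f2.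
  by rewrite mul0r mul0r addr0; exact: le_trans.
have ae1 : {ae P2, forall w, forall i, `|eta i w| <= 1}.
  exact: filter_forall.
apply: ae_ge0_le_integral => //.
- by move=> w _; rewrite lee_fin.
- by apply/measurable_EFinP; exact: (mfS _ _ _ eta).
- move=> w _; rewrite lee_fin /sign_weight_mix sumr_ge0// => s _.
  rewrite mulr_ge0// prodr_ge0// => i _.
  by case/andP: (sign_weight_itv (s i) (eta i w)).
- by apply/measurable_EFinP; exact: measurable_sign_weight_mix.
apply: filterS ae1 => w w1 _; rewrite lee_fin sign_weight_mixE//.
rewrite -[X in f X]add0r; apply: le_signed_mix => // i b.
exact: second_derivative_ge0_chord.
Qed.
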